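(* Let $\Omega\subset\mathbb C^d$ be a bounded domain such that $(\Omega,K_\Omega)$ is a complete metric space. Assume that $\Omega$ is visible. If there exist $p\in\partial\Omega$ and an open neighborhood $U$ of $p$ such that $U\cap\Omega$ has at least two connected components whose closures contain $p$, then there exists a geodesic loop for $\overline\Omega$ with vertex $p$.
   Context: $K_\Omega$ is the Kobayashi distance of $\Omega$; $\partial\Omega$, $\overline\Omega$ are the Euclidean boundary and closure. Geodesics: a geodesic is a curve $\gamma:I\to\Omega$ ($I\subset\mathbb R$ an interval) with $K_\Omega(\gamma(s),\gamma(t))=|s-t|$ for all $s,t\in I$; it is a geodesic segment if $I$ is compact and a geodesic line if $I=\mathbb R$. Visible: $\Omega$ is visible if for all $p,q\in\partial\Omega$ with $p\neq q$ there exist neighborhoods $V_p$ of $p$ and $V_q$ of $q$ with $V_p\cap V_q=\emptyset$ and a compact set $K\subset\Omega$ such that every geodesic segment joining a point $x\in V_p\cap\Omega$ to a point $y\in V_q\cap\Omega$ intersects $K$. Geodesic loop: a geodesic loop for $\overline\Omega$ is a geodesic line $\gamma:(-\infty,+\infty)\to\Omega$ having the same cluster set $\Gamma$ in $\overline\Omega$ at $+\infty$ and at $-\infty$; $\Gamma$ is called the vertex of the loop. The vertex is $p$ when $\Gamma=\{p\}$, i.e. $\lim_{t\to\pm\infty}\gamma(t)=p$. *)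

(* Defs.v *)
From mathcomp Require Import all_boot all_order all_algebra.
From mathcomp Require Import all_classical all_reals all_analysis.
From mathcomp Require Import complex.

Set Implicit Arguments.
Unset Strict Implicit.
Unset Printing Implicit Defensive.

Import Order.TTheory GRing.Theory Num.Theory.
Import numFieldNormedType.Exports.

Local Open Scope classical_set_scope.
Local Open Scope ring_scope.

(* [R[i]] seen as a [numFieldType], so that it and the row vectors over it
   inherit the topology and the normed-module structure that MathComp-Analysis
   gives to an arbitrary [numFieldType]. *)
Definition Cplx (R : realType) : numFieldType := R[i]%C.

(* The norm of a row vector is the maximum of the moduli of the coordinates; it induces the
   Euclidean topology and the same bounded sets. *)
Notation "''C[' R ]^ d" := ('rV[Cplx R]_d)
  (at level 8, R at level 2, d at level 2, format "''C[' R ]^ d").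

(* The norm of a [numFieldType] takes its values in the field itself, hence
   the real part. *)
Definition cmod (R : realType) (z : Cplx R) : R := complex.Re `|z|.

Definition unit_disc (R : realType) : set (Cplx R) := [set z | cmod z < 1].

Definition cconj (R : realType) (z : Cplx R) : Cplx R := (z : R[i]%C)^*%C.

(* Normalised to have constant curvature -4. *)
Definition poincare_dist (R : realType) (z w : Cplx R) : R :=
  let t := cmod ((z - w) / (1 - cconj w * z)) in
  2^-1 * ln ((1 + t) / (1 - t)).

Section Kobayashi.
Variables (R : realType) (d : nat) (Omega : set 'C[R]^d).

(* [f] is total; only its restriction to the unit disc matters.  Derivability
   over [Cplx R] in the direction 1 is complex differentiability. *)
Definition holomorphic_disc (f : Cplx R -> 'C[R]^d) :=
  forall z, unit_disc z -> derivable f z 1 /\ Omega (f z).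

(* [disc_chain x y l]: a chain of analytic discs of total length [l] joins
   [x] to [y]. *)
Inductive disc_chain : 'C[R]^d -> 'C[R]^d -> R -> Prop :=
| disc_chain1 f z w :
    holomorphic_disc f -> unit_disc z -> unit_disc w ->
    disc_chain (f z) (f w) (poincare_dist z w)
| disc_chainS f z w y l :
    holomorphic_disc f -> unit_disc z -> unit_disc w ->
    disc_chain (f w) y l ->
    disc_chain (f z) y (poincare_dist z w + l).

(* On a domain any two points are joined by a chain, so this is never the
   infimum of the empty set (which is 0 by convention) for x, y in Omega. *)
Definition kobayashi (x y : 'C[R]^d) : R := inf [set l | disc_chain x y l].

Definition geodesic (I : set R) (g : R -> 'C[R]^d) :=
  [/\ is_interval I,
      {within I, continuous g},
      forall t, I t -> Omega (g t)
    & forall s t, I s -> I t -> kobayashi (g s) (g t) = `|s - t|].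

Definition geodesic_segment (a b : R) (g : R -> 'C[R]^d) :=
  a <= b /\ geodesic `[a, b] g.

Definition geodesic_line (g : R -> 'C[R]^d) := geodesic setT g.

End Kobayashi.

Definition boundary (T : topologicalType) (A : set T) : set T :=
  closure A `\` interior A.

Definition domain (T : topologicalType) (A : set T) :=
  [/\ open A, connected A & A !=set0].

Definition component_of (T : topologicalType) (A C : set T) :=
  exists2 x, A x & C = connected_component A x.

Definition metric_on (R : realType) (T : Type) (A : set T) (dist : T -> T -> R) :=
  [/\ forall x y, A x -> A y -> dist x y = 0 <-> x = y,
      forall x y, A x -> A y -> dist x y = dist y x
    & forall x y z, A x -> A y -> A z -> dist x z <= dist x y + dist y z].

Definition complete_metric_on (R : realType) (T : Type) (A : set T)
    (dist : T -> T -> R) :=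
  metric_on A dist /\
  forall u : nat -> T, (forall n, A (u n)) ->
    (forall e : R, 0 < e -> exists N : nat, forall m n : nat,
      (N <= m)%N -> (N <= n)%N -> dist (u m) (u n) < e) ->
    exists2 l, A l & (fun n => dist (u n) l) @ \oo --> (0 : R).

Definition visible (R : realType) (d : nat) (Omega : set 'C[R]^d) :=
  forall p q, boundary Omega p -> boundary Omega q -> p <> q ->
  exists Vp Vq K : set 'C[R]^d,
    [/\ nbhs p Vp, nbhs q Vq, Vp `&` Vq = set0, compact K & K `<=` Omega] /\
    forall (a b : R) (g : R -> 'C[R]^d), geodesic_segment Omega a b g ->
      (Vp `&` Omega) (g a) -> (Vq `&` Omega) (g b) ->
      exists2 t, t \in `[a, b] & K (g t).

Definition cluster_pinfty (R : realType) (d : nat) (Omega : set 'C[R]^d)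
    (g : R -> 'C[R]^d) : set 'C[R]^d :=
  closure Omega `&` cluster (g t @[t --> +oo]).

Definition cluster_ninfty (R : realType) (d : nat) (Omega : set 'C[R]^d)
    (g : R -> 'C[R]^d) : set 'C[R]^d :=
  closure Omega `&` cluster (g t @[t --> -oo]).

Definition geodesic_loop (R : realType) (d : nat) (Omega : set 'C[R]^d)
    (g : R -> 'C[R]^d) :=
  geodesic_line Omega g /\ cluster_pinfty Omega g = cluster_ninfty Omega g.

Definition loop_vertex (R : realType) (d : nat) (Omega : set 'C[R]^d)
    (g : R -> 'C[R]^d) : set 'C[R]^d := cluster_pinfty Omega g.

(* Main.v *)
From mathcomp Require Import ring lra complex.
Require Import Defs.
From mathcomp Require Import all_boot all_order all_algebra.
From mathcomp Require Import all_classical all_reals all_analysis.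
Import Order.TTheory GRing.Theory Num.Theory.
Import numFieldNormedType.Exports.

(* Choose x_n, y_n converging to p in two different components of U `&` Omega.
   By Hopf-Rinow a geodesic segment joins x_n to y_n; it has to leave U, and
   visibility between p and a boundary limit of the exit points (or convergence
   of the exit points inside Omega) gives points of the segments at bounded
   distance from a fixed o.  Completeness makes both sides of the segments
   arbitrarily long, so that, re-parametrised from these points, the segments
   have a pointwise limit, which is a geodesic line.  If it accumulated at
   infinity on some q <> p, visibility between q and p would bring the segments
   back to a compact set at arbitrarily large times, which is absurd for
   geodesics. *)

Set Implicit Arguments.
Unset Strict Implicit.
Unset Printing Implicit Defensive.

Local Open Scope classical_set_scope.
Local Open Scope ring_scope.

(** * The Poincare disc *)

(** Completeness and geodesics refer to the Kobayashi distance K, visibility and the vertex to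
    Euclidean neighbourhoods, so the two topologies have to be identified. K is also a length
    metric, as Hopf-Rinow requires: replacing each link of a chain of discs by the image of a
    Poincare geodesic turns the chain into a 1-Lipschitz path of the same length.

    Parametrised from [x_n], the segments would have no limit inside Omega, since [x_n] leaves every
    K-ball. Parametrised from points within [M] of [o], they are at time [t] in the ball of radius
    [M + |t|], which is compact. Leaving U does not by itself supply such points, as the exit points
    may tend to the boundary; it only ensures that their limit differs from p, and visibility turns
    this into a bound.

    All limits are taken along one ultrafilter on the integers. In a compact set every sequence
    converges along it, so that all times are treated at once and no subsequence is extracted. *)

Section ComplexModulus.
Context {R : realType}.
Implicit Types (z w : Cplx R) (r : R).

Lemma cmodE z : cmod z = Num.sqrt (complex.Re z ^+ 2 + complex.Im z ^+ 2).
Proof. by rewrite /cmod normc_def. Qed.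

Lemma norm_cmod z : `|z| = (cmod z)%:C%C :> Cplx R.
Proof. by rewrite /cmod; case: z. Qed.

Lemma cmod_ge0 z : 0 <= cmod z.
Proof. by rewrite cmodE sqrtr_ge0. Qed.

Lemma sqr_cmod z : cmod z ^+ 2 = complex.Re z ^+ 2 + complex.Im z ^+ 2.
Proof. by rewrite cmodE sqr_sqrtr// addr_ge0// sqr_ge0. Qed.

Lemma cmodM z w : cmod (z * w) = cmod z * cmod w.
Proof. by apply: (@complexI R); rewrite rmorphM/= -!norm_cmod normrM. Qed.

Lemma cmodV z : cmod z^-1 = (cmod z)^-1.
Proof. by apply: (@complexI R); rewrite fmorphV/= -!norm_cmod normfV. Qed.

Lemma cmodN z : cmod (- z) = cmod z.
Proof. by rewrite /cmod normrN. Qed.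

Lemma cmod_cconj z : cmod (cconj z) = cmod z.
Proof. by rewrite !cmodE; case: z => a b /=; rewrite sqrrN. Qed.

Lemma cmod_eq0 z : (cmod z == 0) = (z == 0).
Proof. by rewrite -(inj_eq (@complexI R)) -norm_cmod normr_eq0. Qed.

Lemma cmod_real r : cmod (r%:C%C : Cplx R) = `|r|.
Proof. by rewrite cmodE /= expr0n /= addr0 sqrtr_sqr. Qed.

Lemma cconj_real r : cconj (r%:C%C : Cplx R) = r%:C%C.
Proof. by rewrite /cconj /= oppr0. Qed.

Lemma cconjM z w : cconj (z * w) = cconj z * cconj w.
Proof. exact: (rmorphM (@conjc R)). Qed.

Lemma cconjD z w : cconj (z + w) = cconj z + cconj w.
Proof. exact: (rmorphD (@conjc R)). Qed.

Lemma cconjN z : cconj (- z) = - cconj z.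
Proof. exact: (rmorphN (@conjc R)). Qed.

Lemma cconjB z w : cconj (z - w) = cconj z - cconj w.
Proof. exact: (rmorphB (@conjc R)). Qed.

Lemma cconj0 : cconj 0 = 0 :> Cplx R.
Proof. exact: conjc0. Qed.

Lemma cconjV z : cconj z^-1 = (cconj z)^-1.
Proof. exact: (conjc_inv z). Qed.

Lemma cconj1 : cconj 1 = 1 :> Cplx R.
Proof. exact: conjc1. Qed.

Lemma cconjK z : cconj (cconj z) = z.
Proof. exact: conjcK. Qed.

Lemma continuous_real_complex : continuous (fun r => r%:C%C : Cplx R).
Proof.
move=> r; apply/cvgrPdist_lt => e e0.
have eE : e = (complex.Re e)%:C%C by rewrite RRe_real// gtr0_real.
have e0' : 0 < complex.Re e by move: e0; rewrite eE ltcR.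
near=> t.
rewrite -[X in `|X|](rmorphB (real_complex R)) norm_cmod cmod_real eE ltcR.
near: t; exact: cvgr_dist_lt.
Unshelve. all: by end_near. Qed.

End ComplexModulus.

(** * Disc automorphisms and the pseudohyperbolic distance *)

Section Mobius.
Context {R : realType}.
Implicit Types (z w x y : Cplx R) (r s t : R).

Definition mobius z x : Cplx R := (x + z) / (1 + cconj z * x).

(** The pseudohyperbolic distance, of which [poincare_dist] is the inverse hyperbolic tangent. *)
Definition pseudo_dist z w : R := cmod ((z - w) / (1 - cconj w * z)).

Lemma add1_cconjM_neq0 z x : unit_disc z -> unit_disc x -> 1 + cconj z * x != 0.
Proof.
rewrite /unit_disc /= => z1 x1; apply/eqP => /eqP.
rewrite addr_eq0 => /eqP/(congr1 (@cmod R)).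
rewrite cmodN cmodM cmod_cconj -[1]/((1 : R)%:C%C) cmod_real normr1 => h.
by have := mulr_ilt1 (cmod_ge0 z) (cmod_ge0 x) z1 x1; rewrite -h ltxx.
Qed.

Lemma unit_discN z : unit_disc z -> unit_disc (- z).
Proof. by rewrite /unit_disc /= cmodN. Qed.

(** The squared moduli of denominator and numerator differ by [(1 - |z|^2) (1 - |x|^2)], which is
    positive. *)
Lemma mobius_disc z x : unit_disc z -> unit_disc x -> unit_disc (mobius z x).
Proof.
move=> z1 x1; have := add1_cconjM_neq0 z1 x1.
rewrite -cmod_eq0 => n0.
have n1 : 0 < cmod (1 + cconj z * x) by rewrite lt0r n0 cmod_ge0.
rewrite /unit_disc /mobius /= cmodM cmodV ltr_pdivrMr// mul1r.
rewrite -(@ltr_pXn2r _ 2)// ?nnegrE ?cmod_ge0// !sqr_cmod.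
have : 0 < (1 - cmod z ^+ 2) * (1 - cmod x ^+ 2).
  by rewrite mulr_gt0// subr_gt0 expr_lt1// cmod_ge0.
rewrite !sqr_cmod -subr_gt0; congr (_ < _).
case: z {z1 x1 n0 n1} => a b; case: x => c d /=; ring.
Qed.

Lemma mobius0 z : mobius z 0 = z.
Proof. by rewrite /mobius add0r mulr0 addr0 divr1. Qed.

Lemma mobiusK z w : unit_disc z -> unit_disc w ->
  mobius z ((w - z) / (1 - cconj z * w)) = w.
Proof.
move=> z1 w1; rewrite /mobius.
have := add1_cconjM_neq0 (unit_discN z1) w1; rewrite cconjN mulNr => n0.
have n1 := add1_cconjM_neq0 (unit_discN z1) z1.
move: n1; rewrite cconjN mulNr => n1.
field.
rewrite n0 /=.
set zb := cconj z in n0 n1 *.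
have -> : 1 - zb * w + zb * (w - z) = 1 - zb * z by ring.
by [].
Qed.

(** The two quotients differ by the factor [(1 + z ybar) / conj (1 + z ybar)], of modulus 1. *)
Lemma mobius_pseudo_dist z x y : unit_disc z -> unit_disc x -> unit_disc y ->
  pseudo_dist (mobius z x) (mobius z y) = pseudo_dist x y.
Proof.
move=> z1 x1 y1; rewrite /pseudo_dist.
set q := (x - y) / _.
have nx := add1_cconjM_neq0 z1 x1.
have ny := add1_cconjM_neq0 z1 y1.
have ny' : 1 + z * cconj y != 0.
  by rewrite mulrC addrC; apply: contraNneq ny => h; apply/eqP;
    apply: (can_inj (@cconjK R)); rewrite !cconjD !cconjM cconjK cconj1 mulrC addrC h cconj0.
have nz : 1 - cconj z * z != 0.
  have := add1_cconjM_neq0 (unit_discN z1) z1.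
  by rewrite cconjN mulNr.
have nxy : 1 - cconj y * x != 0.
  have := add1_cconjM_neq0 (unit_discN y1) x1.
  by rewrite cconjN mulNr.
have -> : (mobius z x - mobius z y) / (1 - cconj (mobius z y) * mobius z x) =
   q * ((1 + z * cconj y) / cconj (1 + z * cconj y)).
  rewrite /q /mobius !(cconjM, cconjV, cconjD, cconj1, cconjK).
  set zb := cconj z in nx ny nz *; set yb := cconj y in ny' nxy *.
  field.
  rewrite nx ny ny' nxy.
  have -> : (1 + z * yb) * (1 + zb * x) - (yb + zb) * (x + z) =
      (1 - yb * x) * (1 - zb * z) by ring.
  by rewrite mulf_neq0.
rewrite cmodM [X in _ * X]cmodM cmodV cmod_cconj mulfV ?mulr1//.
by rewrite cmod_eq0.
Qed.

End Mobius.

Lemma continuous_homography (K : numFieldType) (a c x : K) : 1 + c * x != 0 ->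
  {for x, continuous (fun y => (y + a) / (1 + c * y))}.
Proof.
move=> n0; have cy : y @[y --> x] --> x by exact: cvg_id.
have cd : 1 + c * y @[y --> x] --> 1 + c * x.
  apply: (@cvgD _ _ _ (nbhs x)); first exact: cvg_cst.
  by apply: (@cvgM _ _ (nbhs x)) => //; exact: cvg_cst.
apply: (@cvgM _ _ (nbhs x)); last exact: (@cvgV _ _ (nbhs x)).
by apply: (@cvgD _ _ _ (nbhs x)) => //; exact: cvg_cst.
Qed.

(** * Unit-speed geodesics of the Poincare disc *)

Section PoincareGeodesic.
Context {R : realType}.
Implicit Types (z w x y : Cplx R) (r s t : R).

Definition tanhR t : R := (expR (2 * t) - 1) / (expR (2 * t) + 1).

Lemma expR_add1_neq0 t : expR t + 1 != 0 :> R.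
Proof. by rewrite gt_eqF// addr_gt0// expR_gt0. Qed.

Lemma tanhR0 : tanhR 0 = 0.
Proof. by rewrite /tanhR mulr0 expR0 subrr mul0r. Qed.

Lemma tanhR_lt1 t : `|tanhR t| < 1.
Proof.
rewrite /tanhR; have := expR_gt0 (2 * t); set u := expR _ => u0.
rewrite normrM normfV (gtr0_norm (_ : 0 < u + 1)) ?ltr_pdivrMr ?addr_gt0//.
by rewrite mul1r ltr_norml; lra.
Qed.

Lemma tanhR_gt0 t : 0 < t -> 0 < tanhR t.
Proof. by move=> t0; rewrite /tanhR divr_gt0// ?subr_gt0 ?expR_gt1 ?mulr_gt0. Qed.

Lemma continuous_tanhR : continuous tanhR.
Proof.
move=> t; have c2 : {for t, continuous (fun u : R => expR (2 * u) : R)}.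
  apply: (@continuous_comp _ _ _ (fun u : R => 2 * u) expR); last exact: continuous_expR.
  by apply: cvgM; [exact: cvg_cst|exact: cvg_id].
apply: cvgM; first by apply: cvgB => //; exact: cvg_cst.
apply: cvgV; first exact: expR_add1_neq0.
by apply: cvgD => //; exact: cvg_cst.
Qed.

(** [tanhR] parametrises the real diameter by arc length: with [S = exp (2s)] and [T = exp (2t)] the
    quotient is [- (T - S) / (T + S)], so that the argument of [ln] is [T / S]. *)
Lemma poincare_dist_tanhR s t : s <= t ->
  2^-1 * ln ((1 + `|(tanhR s - tanhR t) / (1 - tanhR t * tanhR s)|) /
     (1 - `|(tanhR s - tanhR t) / (1 - tanhR t * tanhR s)|)) = t - s.
Proof.
move=> st; rewrite /tanhR.
have S0 := expR_gt0 (2 * s); have T0 := expR_gt0 (2 * t).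
have ST : expR (2 * s) <= expR (2 * t) by rewrite ler_expR ler_pM2l.
have -> : ((expR (2 * s) - 1) / (expR (2 * s) + 1) -
   (expR (2 * t) - 1) / (expR (2 * t) + 1)) /
  (1 -
   (expR (2 * t) - 1) / (expR (2 * t) + 1) *
   ((expR (2 * s) - 1) / (expR (2 * s) + 1))) =
  - ((expR (2 * t) - expR (2 * s)) / (expR (2 * t) + expR (2 * s))).
  by field; rewrite !gt_eqF//; nra.
rewrite normrN ger0_norm; last by rewrite divr_ge0// ?subr_ge0// addr_ge0// ltW.
have -> : (1 + (expR (2 * t) - expR (2 * s)) / (expR (2 * t) + expR (2 * s))) /
   (1 - (expR (2 * t) - expR (2 * s)) / (expR (2 * t) + expR (2 * s))) =
   expR (2 * t) / expR (2 * s).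
  by field; rewrite !gt_eqF//; lra.
by rewrite -expRB expRK; field.
Qed.

Lemma poincare_distE z w :
  poincare_dist z w = 2^-1 * ln ((1 + pseudo_dist z w) / (1 - pseudo_dist z w)).
Proof. by []. Qed.

Lemma pseudo_dist_lt1 z w : unit_disc z -> unit_disc w -> pseudo_dist z w < 1.
Proof.
move=> z1 w1; have := mobius_disc (unit_discN w1) z1.
by rewrite /unit_disc /= /mobius /pseudo_dist cconjN mulNr.
Qed.

Lemma poincare_dist_ge0 z w : unit_disc z -> unit_disc w -> 0 <= poincare_dist z w.
Proof.
move=> z1 w1; rewrite poincare_distE mulr_ge0// ln_ge0//.
have := pseudo_dist_lt1 z1 w1; have := cmod_ge0 ((z - w) / (1 - cconj w * z)).
rewrite -/(pseudo_dist z w) => p0 p1.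
by rewrite ler_pdivlMr; lra.
Qed.

Lemma tanhR_atanh r : 0 <= r -> r < 1 -> tanhR (2^-1 * ln ((1 + r) / (1 - r))) = r.
Proof.
move=> r0 r1; rewrite /tanhR mulrA mulfV// mul1r lnK; last first.
  by rewrite posrE divr_gt0//; lra.
by field; rewrite !gt_eqF//; lra.
Qed.

Lemma pseudo_distC z w : pseudo_dist z w = pseudo_dist w z.
Proof.
rewrite /pseudo_dist cmodM [RHS]cmodM -cmodN opprB; congr (_ * _).
rewrite -cmod_cconj cconjV !cmodV; congr (_^-1).
by rewrite cconjB cconjM cconjK cconj1 mulrC.
Qed.

Lemma pseudo_dist_tanhR e s t : cmod e = 1 -> s <= t ->
  pseudo_dist ((tanhR s)%:C%C * e) ((tanhR t)%:C%C * e) =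
  `|(tanhR s - tanhR t) / (1 - tanhR t * tanhR s)|.
Proof.
move=> e1 st; rewrite /pseudo_dist -mulrBl cconjM cconj_real.
have ee : cconj e * e = 1.
  have := sqr_cmod e; rewrite e1 expr1n.
  case: e {e1} => a b /= h; rewrite /cconj.
  by apply/eqP; rewrite eq_complex /=; apply/andP; split; apply/eqP; [rewrite h|]; ring.
rewrite mulrACA ee mulr1 cmodM cmodV cmodM e1 mulr1.
rewrite -[1 in X in _ * X]/((1 : R)%:C%C).
by rewrite -(rmorphM (real_complex R)) -!(rmorphB (real_complex R)) !cmod_real normrM normfV.
Qed.

Lemma tanhR_disc e t : cmod e = 1 -> unit_disc ((tanhR t)%:C%C * e).
Proof. by move=> e1; rewrite /unit_disc /= cmodM e1 mulr1 cmod_real tanhR_lt1. Qed.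

Lemma continuous_mobius z x : unit_disc z -> unit_disc x ->
  {for x, continuous (mobius z)}.
Proof. by move=> z1 x1; exact: continuous_homography (add1_cconjM_neq0 z1 x1). Qed.

(** A Mobius map brings [z] to 0 and [w] to [m]; the diameter in the direction [e] of [m],
    parametrised by [tanhR], is moved back. Any unit [e] will do when [m = 0]. *)
Lemma poincare_geodesic z w : unit_disc z -> unit_disc w ->
  exists u : R -> Cplx R, [/\ continuous u, forall t, unit_disc (u t),
    u 0 = z, u (poincare_dist z w) = w &
    forall s t, s <= t -> poincare_dist (u s) (u t) = t - s].
Proof.
move=> z1 w1; pose m := (w - z) / (1 - cconj z * w).
have mE : cmod m = pseudo_dist z w by rewrite pseudo_distC.
have [e e1 em] : exists2 e, cmod e = 1 & m = (cmod m)%:C%C * e.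
  have [->|m0] := eqVneq m 0.
    exists 1; first by rewrite -[1]/((1 : R)%:C%C) cmod_real normr1.
    by rewrite cmodE /= expr0n /= addr0 sqrtr0 mul0r.
  exists (m / (cmod m)%:C%C).
    by rewrite cmodM cmodV cmod_real ger0_norm ?cmod_ge0// mulfV// cmod_eq0.
  rewrite mulrCA mulfV ?mulr1//.
  by rewrite -cmod_eq0 cmod_real normr_eq0 cmod_eq0.
exists (fun t => mobius z ((tanhR t)%:C%C * e)); split.
- move=> t; apply: (@continuous_comp _ _ _ (fun t => (tanhR t)%:C%C * e : Cplx R)); last first.
    by apply: continuous_mobius => //; exact: tanhR_disc.
  apply: cvgM; last exact: cvg_cst.
  apply: (@continuous_comp _ _ _ tanhR); first exact: continuous_tanhR.
  exact: continuous_real_complex.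
- by move=> t; apply: mobius_disc => //; exact: tanhR_disc.
- by rewrite tanhR0 mul0r mobius0.
- rewrite poincare_distE -mE tanhR_atanh ?cmod_ge0//; last by rewrite mE pseudo_dist_lt1.
  by rewrite -em mobiusK.
- move=> s t st; rewrite poincare_distE mobius_pseudo_dist//; do ?exact: tanhR_disc.
  by rewrite pseudo_dist_tanhR// poincare_dist_tanhR.
Qed.

End PoincareGeodesic.

(** * Chains of analytic discs *)

Section Chains.
Context {R : realType} {d : nat} (Omega : set 'C[R]^d).
Implicit Types (x y z : 'C[R]^d) (l r s t : R).

Lemma disc_chain_ge0 x y l : disc_chain Omega x y l -> 0 <= l.
Proof.
elim=> [f z w _ z1 w1|f z w y' m _ z1 w1 _ m0]; first exact: poincare_dist_ge0.
by rewrite addr_ge0// poincare_dist_ge0.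
Qed.

Lemma disc_chain_refl x : Omega x -> disc_chain Omega x x 0.
Proof.
move=> Ox; have d0 : unit_disc (0 : Cplx R).
  by rewrite /unit_disc /= /cmod normr0.
have -> : 0 = poincare_dist (0 : Cplx R) 0.
  by rewrite poincare_distE /pseudo_dist subrr mul0r /cmod normr0 subr0 addr0 divr1 ln1 mulr0.
by apply: (@disc_chain1 _ _ _ (fun=> x) 0 0).
Qed.

Lemma kobayashi_le x y l : disc_chain Omega x y l -> kobayashi Omega x y <= l.
Proof. by move=> c; apply: ge_inf => //; exists 0 => m /disc_chain_ge0. Qed.

Lemma kobayashi_ge0 x y : 0 <= kobayashi Omega x y.
Proof.
have [[l c]|n] := pselect ([set l | disc_chain Omega x y l] !=set0).
  by apply: lb_le_inf => [|m /disc_chain_ge0//]; exists l.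
rewrite /kobayashi (_ : [set _ | _] = set0) ?inf0//.
by rewrite -subset0 => l c; apply: n; exists l.
Qed.

Lemma holomorphic_disc_continuous f (z : Cplx R) : holomorphic_disc Omega f -> unit_disc z ->
  {for z, continuous f}.
Proof.
by move=> fh z1; apply/differentiable_continuous/derivable1_diffP; have [] := fh _ z1.
Qed.

(** Each disc contributes the image of a Poincare geodesic, and these are concatenated; every
    subpath is again a chain, of length exactly the elapsed time. Connectedness of the image is
    enough to make the path cross a sphere, and passes to concatenations as a union of two connected
    sets with a common point. *)
Lemma disc_chain_path x y l : disc_chain Omega x y l ->
  exists g : R -> 'C[R]^d, [/\ g 0 = x, g l = y, connected (g @` `[0, l]) &
    forall s t, 0 <= s -> s <= t -> t <= l ->
      [/\ Omega (g s), Omega (g t) & disc_chain Omega (g s) (g t) (t - s)]].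
Proof.
have disc f (z w : Cplx R) : holomorphic_disc Omega f -> unit_disc z -> unit_disc w ->
    exists u : R -> Cplx R, [/\ forall t, unit_disc (u t), u 0 = z,
      u (poincare_dist z w) = w,
      connected ((f \o u) @` `[0, poincare_dist z w]) &
      forall s t, s <= t -> poincare_dist (u s) (u t) = t - s].
  move=> fh z1 w1; have [u [uc ud u0 uw us]] := poincare_geodesic z1 w1.
  exists u; split=> //; apply: connected_continuous_connected.
    exact: segment_connected.
  apply: continuous_subspaceT => t; apply: continuous_comp; first exact: uc.
  exact: holomorphic_disc_continuous.
elim=> {x y l} [f z w fh z1 w1|f z w y m fh z1 w1 cm [g [g0 gm gc gs]]].
  have [u [ud u0 uw uc us]] := disc f z w fh z1 w1.
  exists (f \o u); split=> /=; rewrite ?u0 ?uw//.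
  move=> s t _ st _; split; [by case: (fh _ (ud s))|by case: (fh _ (ud t))|].
  by rewrite -us//; exact: disc_chain1.
have [u [ud u0 uw uc us]] := disc f z w fh z1 w1.
set r := poincare_dist z w in uw uc *.
have r0 : 0 <= r by exact: poincare_dist_ge0.
have m0 := disc_chain_ge0 cm.
pose h t := if t <= r then f (u t) else g (t - r).
have hr t : r <= t -> h t = g (t - r).
  rewrite le_eqVlt => /predU1P[<-|rt]; last by rewrite /h leNgt rt.
  by rewrite /h lexx uw subrr g0.
have hu t : t <= r -> h t = f (u t) by rewrite /h => ->.
exists h; split.
- by rewrite hu// u0.
- by rewrite hr ?lerDl// addrC addKr.
- have -> : h @` `[0, r + m] = (f \o u) @` `[0, r] `|` g @` `[0, m].
    apply/seteqP; split=> [v [t /=]|v].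
      rewrite in_itv /= => /andP[t0 tr] <- {v}.
      have [tr'|/ltW rt] := leP t r.
        by left; exists t; rewrite ?hu//= in_itv /= t0.
      by right; exists (t - r); rewrite ?hr//= in_itv /= subr_ge0 rt lerBlDl.
    move=> [[t /=]|[t /=]]; rewrite in_itv /= => /andP[t0 tr] <-.
      by exists t; rewrite ?hu//= in_itv /= t0 (le_trans tr)// lerDl.
    exists (r + t); last by rewrite hr ?lerDl// addrC addKr.
    by rewrite /= in_itv /= addr_ge0// lerD2l.
  apply: connectedU => //; exists (f w); split.
    by exists r; rewrite /= ?uw// in_itv /= r0 lexx.
  by exists 0; rewrite // /= in_itv /= lexx.
move=> s t s0 st tl; have fu v : Omega (f (u v)) by have [] := fh _ (ud v).
have [tr|/ltW rt] := leP t r.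
  by rewrite !hu ?(le_trans st)//; split => //; rewrite -us//; exact: disc_chain1.
have tm : t - r <= m by rewrite lerBlDl.
have tr0 : 0 <= t - r by rewrite subr_ge0.
have [sr|/ltW rs] := leP s r.
  have [_ Og cg] := gs 0 (t - r) (lexx 0) tr0 tm.
  rewrite hu// hr//; split => //.
  have -> : t - s = poincare_dist (u s) (u r) + (t - r - 0).
    by rewrite us//; ring.
  by apply: disc_chainS => //; rewrite uw -g0.
rewrite !hr//.
have [||Os Ot ct] := gs (s - r) (t - r) _ _ tm; rewrite ?subr_ge0 ?lerB//.
by split=> //; have -> : t - s = t - r - (s - r) by ring.
Qed.

End Chains.

(** * Hopf-Rinow for complete length metrics *)

(** An ultrafilter contains each set or its complement, so a cluster point is already a limit. *)
Lemma ultra_cvg_compact (S : Type) (T : topologicalType) (F : set_system S)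
    (f : S -> T) (C : set T) : UltraFilter F -> compact C ->
  F (f @^-1` C) -> exists2 p, C p & f @ F --> p.
Proof.
move=> FU Cc FC; have [p [Cp clp]] := Cc (f @ F) _ FC; exists p => // N pN.
have [//|FnN] := in_ultra_setVsetC (f @^-1` N) FU.
by have [y []] := clp (~` N) N FnN pN.
Qed.

(** Stands in for the extraction of subsequences: what holds for all large [n] holds along [F]. *)
Lemma exists_ultra_oo : exists2 F : set_system nat, UltraFilter F & \oo `<=` F.
Proof. by have [F [? ?]] := ultraFilterLemma (F := \oo) _; exists F. Qed.

Section MetricGeometry.
Context {R : realType} {T : topologicalType} (A : set T) (K : T -> T -> R).
Implicit Types (x y z : T) (r s t e : R).

(** Besides the agreement of the topologies, this contains the openness of [A]: take [V = A]. *)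
Definition metric_nbhs := forall x, A x -> forall V : set T,
  nbhs x V <-> exists2 e, 0 < e & forall y, A y -> K x y < e -> V y.

Definition kball x r : set T := [set y | A y /\ K x y <= r].

Definition lipschitz_path x y l (g : R -> T) := [/\ g 0 = x, g l = y &
  forall s t, 0 <= s -> s <= t -> t <= l ->
    [/\ A (g s), A (g t) & K (g s) (g t) <= t - s]].

(** Length spaces without lengths of curves: the duration [l] of a 1-Lipschitz path stands for its
    length. *)
Definition length_metric := forall x y e, A x -> A y -> 0 < e ->
  exists l g, [/\ 0 <= l, l < K x y + e & lipschitz_path x y l g].

(** Omits the interval and continuity conditions of [geodesic]; continuity follows from
    [metric_nbhs]. *)
Definition isometric_on (I : set R) (g : R -> T) :=
  forall s t, I s -> I t -> A (g s) /\ K (g s) (g t) = `|s - t|.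

Hypothesis metricK : metric_on A K.
Hypothesis nbhsK : metric_nbhs.

Lemma metric_sym x y : A x -> A y -> K x y = K y x.
Proof. by case: metricK => _ + _; exact. Qed.

Lemma metric_triangle y x z : A x -> A y -> A z -> K x z <= K x y + K y z.
Proof. by move=> ? ? ?; case: metricK => _ _; exact. Qed.

Lemma metric_refl x : A x -> K x x = 0.
Proof. by move=> Ax; case: metricK => h _ _; apply/h. Qed.

Lemma metric_eq0 x y : A x -> A y -> K x y = 0 -> x = y.
Proof. by move=> Ax Ay; case: metricK => h _ _ /h; exact. Qed.

Lemma metric_ge0 x y : A x -> A y -> 0 <= K x y.
Proof.
move=> Ax Ay; have := metric_triangle Ax Ay Ax.
by rewrite metric_refl// (metric_sym Ay Ax) -mulr2n pmulrn_lge0.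
Qed.

Lemma nbhs_metric_ball x e : A x -> 0 < e -> nbhs x [set y | A y /\ K x y < e].
Proof. by move=> Ax e0; apply/nbhsK => //; exists e. Qed.

Lemma cvg_dist0 (S : Type) (F : set_system S) (f : S -> T) p e : Filter F ->
  A p -> f @ F --> p -> 0 < e -> \forall n \near F, A (f n) /\ K p (f n) < e.
Proof. by move=> FF Ap fp e0; exact: (fp _ (nbhs_metric_ball Ap e0)). Qed.

Lemma cvg_metric (S : Type) (F : set_system S) (f g : S -> T) p q : Filter F ->
  A p -> A q -> f @ F --> p -> g @ F --> q ->
  K (f n) (g n) @[n --> F] --> K p q.
Proof.
move=> FF Ap Aq fp gq; apply/cvgrPdist_lt => e e0.
have e2 : 0 < e / 2 by rewrite divr_gt0.
near=> n.
have [Af Kf] : A (f n) /\ K p (f n) < e / 2.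
  by near: n; exact: cvg_dist0.
have [Ag Kg] : A (g n) /\ K q (g n) < e / 2.
  by near: n; exact: cvg_dist0.
have := metric_triangle Ap Af Aq; have := metric_triangle Af Ag Aq.
have := metric_triangle Af Ap Ag; have := metric_triangle Ap Aq Ag.
rewrite (metric_sym Af Ap) (metric_sym Ag Aq) ltr_norml; lra.
Unshelve. all: by end_near. Qed.

Lemma cvg_metricr (S : Type) (F : set_system S) (f : S -> T) o p : Filter F ->
  A o -> A p -> f @ F --> p -> K o (f n) @[n --> F] --> K o p.
Proof. by move=> FF Ao Ap fp; apply: cvg_metric => //; exact: cvg_cst. Qed.

Lemma metricr_continuous o p : A o -> A p -> {for p, continuous (K o)}.
Proof. by move=> Ao Ap; apply: (@cvg_metricr _ (nbhs p) id). Qed.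

(** A cluster point found in [C] lies in [A], where the triangle inequality keeps it in the ball. *)
Lemma compact_subkball x s (C : set T) : A x -> compact C -> C `<=` A ->
  kball x s `<=` C -> compact (kball x s).
Proof.
move=> Ax Cc CA sC F FF FB; have [p [Cp clp]] := Cc F FF (filterS sC FB).
have Ap := CA _ Cp; exists p; split=> //; split => //.
rewrite leNgt; apply/negP => sp.
have /(nbhs_metric_ball Ap) pn : 0 < K x p - s by rewrite subr_gt0.
have [y [[Ay Ky] [_ Kpy]]] := clp _ _ FB pn.
have := metric_triangle Ax Ay Ap; rewrite (metric_sym Ay Ap); lra.
Qed.

Lemma isometric_continuous (I : set R) g : isometric_on I g ->
  {within I, continuous g}.
Proof.
move=> gI; apply/subspace_continuousP => t It V.
have [At _] := gI _ _ It It.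
move=> /(nbhsK At)[e e0 eV].
suff : \forall s \near t, I s -> V (g s) by [].
near=> s => Is; have [As _] := gI _ _ Is Is; apply: eV => //.
have [_ ->] := gI _ _ It Is; near: s; exact: cvgr_dist_lt.
Unshelve. all: by end_near. Qed.

Hypothesis lengthK : length_metric.

(** Cut an almost shortest path at time [r]; what remains lasts less than [s + e]. *)
Lemma kball_intermediate x y r s e : A x -> A y -> 0 <= r -> 0 <= s -> 0 < e ->
  K x y <= r + s -> exists2 z, kball x r z & K z y <= s + e.
Proof.
move=> Ax Ay r0 s0 e0 rs; have [l [g [l0 lK [g0 gl gs]]]] := lengthK Ax Ay e0.
have [lr|/ltW rl] := leP l r.
  exists y; last by rewrite metric_refl// addr_ge0// ltW.
  have [_ _] := gs 0 l (lexx 0) l0 (lexx l).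
  by rewrite g0 gl subr0 => Kl; split=> //; exact: le_trans lr.
have [_ Ar K1] := gs 0 r (lexx 0) r0 rl.
have [_ _ K2] := gs r l r0 rl (lexx l).
rewrite g0 subr0 in K1; rewrite gl in K2; exists (g r); first by split.
by apply: le_trans K2 _; lra.
Qed.

(* Growing the radius by e / 2 at a time: the centres of e-balls swallowing an
   ultrafilter on the larger ball converge in the smaller one. *)
Lemma compact_kball_step x r e : A x -> 0 < e ->
  (forall y, kball x r y -> compact (kball y e)) -> compact (kball x r).
Proof.
move=> Ax e0 cB.
have [r0|r0] := ltP r 0.
  move=> F FF /filter_ex[y [Ay]] /le_lt_trans/(_ r0).
  by rewrite ltNge metric_ge0.
(* The cap at [r] keeps the centres in [kball x r], where the balls of radius [e] are assumed
   compact. *)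
suff cn n : compact (kball x (Num.min r (e / 2 *+ n))).
  have [n rn] : exists n, r <= e / 2 *+ n.
    exists (Num.truncn (r / (e / 2))).+1; rewrite -mulr_natr mulrC -ler_pdivrMr ?divr_gt0//.
    by rewrite ltW// truncnS_gt.
  by have := cn n; rewrite min_l.
have sr s : kball x (Num.min r s) `<=` kball x r.
  by move=> y [Ay]; rewrite le_min => /andP[].
elim: n => [|n IH].
  apply: (@compact_subkball _ _ (kball x e)) => //.
  - by apply: cB; split; rewrite ?metric_refl.
  - by move=> y [].
  - move=> y [Ay]; rewrite mulr0n le_min => /andP[_ xy]; split=> //.
    by rewrite (le_trans xy)// ltW.
rewrite compact_ultra => F FU FB.
have /choice[c cP] : forall y, exists z, kball x (Num.min r (e / 2 *+ n.+1)) y ->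
    kball x (Num.min r (e / 2 *+ n)) z /\ K z y <= e / 2 + e / 4.
  move=> y; have [[Ay]|ny] := pselect (kball x (Num.min r (e / 2 *+ n.+1)) y);
    last by exists x.
  rewrite le_min => /andP[yr yn].
  have [||||| |z zr zy] := @kball_intermediate x y
    (Num.min r (e / 2 *+ n)) (e / 2) (e / 4) => //.
  - by rewrite le_min r0 mulrn_wge0// divr_ge0// ltW.
  - by rewrite divr_ge0// ltW.
  - by rewrite divr_gt0.
  - rewrite mulrS in yn; have [_|_] := leP r (e / 2 *+ n); lra.
  by exists z.
have [z Bz cz] : exists2 z, kball x (Num.min r (e / 2 *+ n)) z & c @ F --> z.
  by apply: ultra_cvg_compact IH _; apply: filterS FB => y /cP[].
have Az : A z by case: Bz.
(* The budget is [e = (e / 2 + e / 4) + e / 4]: from [y] to its centre, and from the centre to the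
   limit [z]. *)
have Fz : F (kball z e).
  have e4 : 0 < e / 4 by rewrite divr_gt0.
  apply: filterS2 FB (cvg_dist0 _ Az cz e4) => y By [Ac Kc].
  have [_ cy] := cP _ By; have Ay : A y by case: By.
  by split=> //; have := metric_triangle Az Ac Ay; lra.
have [p [Ap zp] Fp] := ultra_cvg_compact (f := id) FU (cB _ (sr _ _ Bz)) Fz.
exists p; split=> //; split=> //.
have h : K x y @[y --> F] --> K x p by exact: cvg_metricr.
by apply: (cvgr_to_le h); apply: filterS FB => y [].
Qed.

Hypothesis completeK : forall u : nat -> T, (forall n, A (u n)) ->
  (forall e, 0 < e -> exists N : nat, forall m n : nat,
    (N <= m)%N -> (N <= n)%N -> K (u m) (u n) < e) ->
  exists2 l, A l & (fun n => K (u n) l) @ \oo --> (0 : R).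

Hypothesis locally_compactK : forall x, A x ->
  exists2 e, 0 < e & compact (kball x e).

(** Hopf-Rinow by halving: if the ball of radius [q n] around [u n] is not compact,
    [compact_kball_step] gives in it a centre [u n.+1] whose ball of radius [q n.+1] is not compact.
    The centres form a Cauchy sequence, and a compact ball around their limit swallows the late
    balls. *)
Lemma compact_kball x r : A x -> compact (kball x r).
Proof.
move=> Ax; wlog r0 : r / 0 < r.
  move=> h; apply: (@compact_subkball _ _ (kball x (Num.max r 1))) => //.
  - by apply: h; rewrite lt_max ltr01 orbT.
  - by move=> y [].
  - by move=> y [Ay xy]; split; rewrite // le_max xy.
apply: contrapT => ncx.
pose q n : R := r / 2 ^+ n.
have q0 n : 0 < q n by rewrite /q divr_gt0// exprn_gt0.
have qS n : q n = q n.+1 + q n.+1 by rewrite /q exprS; field; rewrite expf_neq0.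
have /choice[f fP] : forall yn : T * nat, exists z, A yn.1 ->
    ~ compact (kball yn.1 (q yn.2)) ->
    [/\ A z, K yn.1 z <= q yn.2 & ~ compact (kball z (q yn.2.+1))].
  move=> [y n] /=.
  have [[z [Az Kz cz]]|h] := pselect (exists z,
    [/\ A z, K y z <= q n & ~ compact (kball z (q n.+1))]); first by exists z.
  exists y => Ay []; apply: (compact_kball_step Ay (q0 n.+1)) => z [Az Kz].
  by apply: contrapT => cz; apply: h; exists z.
pose fix u n := if n is m.+1 then f (u m, m) else x.
have uP n : A (u n) /\ ~ compact (kball (u n) (q n)).
  elim: n => [|n [Au cu]]; first by rewrite /q expr0 divr1.
  by have [] := fP (u n, n) Au cu.
have uA n : A (u n) by case: (uP n).
have uS n : K (u n) (u n.+1) <= q n.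
  by have [Au cu] := uP n; have [] := fP (u n, n) Au cu.
(* Geometric sum: [q n + ... + q (n + k - 1) = 2 q n - 2 q (n + k)]. *)
have uD n k : K (u n) (u (n + k)%N) <= q n + q n - (q (n + k)%N + q (n + k)%N).
  elim: k => [|k IH]; first by rewrite addn0 metric_refl// subrr.
  have := metric_triangle (uA n) (uA (n + k)%N) (uA (n + k).+1).
  have := uS (n + k)%N; rewrite addnS; have := qS (n + k)%N; lra.
have uD2 m n : (n <= m)%N -> K (u n) (u m) <= q n + q n.
  move=> /subnKC <-; apply: le_trans (uD _ _) _.
  by rewrite gerBl addr_ge0// ltW.
have qsmall e : 0 < e -> exists N, q N < e.
  move=> e0; exists (Num.truncn (r / e)).+1; rewrite /q ltr_pdivrMr ?exprn_gt0//.
  rewrite mulrC -ltr_pdivrMr//; apply: lt_trans (truncnS_gt _) _.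
  by rewrite -natrX ltr_nat ltn_expl.
have [e e0|l Al ul] := @completeK u uA.
  have [N qN] := qsmall (e / 4) (divr_gt0 e0 (ltr0Sn _ _)); exists N => m n Nm Nn.
  have := metric_triangle (uA m) (uA N) (uA n).
  by rewrite (metric_sym (uA m) (uA N)); have := uD2 _ _ Nm; have := uD2 _ _ Nn; lra.
have [e e0 cl] := locally_compactK Al.
have [N qN] := qsmall (e / 4) (divr_gt0 e0 (ltr0Sn _ _)).
have e4 : 0 < e / 4 by rewrite divr_gt0.
have /cvgrPdist_lt/(_ _ e4)[M _ MP] := ul.
have := MP (maxn M N) (leq_maxl _ _); rewrite /= sub0r normrN.
set n := maxn M N => Kn.
have qn : q n <= q N.
  by rewrite /q ler_pM2l// lef_pV2 ?posrE ?exprn_gt0// ler_weXn2l ?leq_maxr// ler1n.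
have [] := uP n => An; apply; apply: (compact_subkball An cl) => [y []//|y [Ay Ky]].
split=> //; have := metric_triangle Al An Ay; rewrite (metric_sym Al An).
have := ler_norm (K (u n) l); lra.
Qed.

(** Values in compact balls converge along [F], with the same [F] for all times of [I]. *)
Lemma ultralimit_path (F : set_system nat) (I : set R) (g : nat -> R -> T) o
    (r : R -> R) : UltraFilter F -> A o ->
  (forall s, I s -> \forall n \near F, kball o (r s) (g n s)) ->
  exists h : R -> T, forall s, I s -> A (h s) /\ g n s @[n --> F] --> h s.
Proof.
move=> FU Ao gI.
have /choice[h hP] : forall s, exists p, I s -> A p /\ g n s @[n --> F] --> p.
  move=> s; have [Is|nI] := pselect (I s); last by exists o.
  have [p [Ap _] gp] :=
    ultra_cvg_compact (f := fun n => g n s) FU (compact_kball Ao) (gI s Is).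
  by exists p.
by exists h.
Qed.

(* Along an ultrafilter, almost shortest paths converge pointwise, without
   Arzela-Ascoli; their Lipschitz limit is forced to be an isometry. *)
Lemma exists_geodesic x y : A x -> A y ->
  exists g : R -> T, [/\ g 0 = x, g (K x y) = y & isometric_on `[0, K x y] g].
Proof.
move=> Ax Ay; have [F FU Foo] := exists_ultra_oo.
have eps0 n : 0 < n.+1%:R^-1 :> R by rewrite invr_gt0.
have /choice[l /choice[g gP]] : forall n, exists l g,
    [/\ 0 <= l, l < K x y + n.+1%:R^-1 & lipschitz_path x y l g].
  by move=> n; have [l [g h]] := lengthK Ax Ay (eps0 n); exists l, g.
have L0 := metric_ge0 Ax Ay; set L := K x y in gP L0 *.
have Ll n : L <= l n.
  have [l0 _ [g0 gl /(_ 0 (l n) (lexx _) l0 (lexx _))[_ _]]] := gP n.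
  by rewrite g0 gl subr0.
have [h hP] : exists h : R -> T, forall s, `[0, L]%classic s ->
    A (h s) /\ g n s @[n --> F] --> h s.
  apply: (@ultralimit_path F _ g x id FU Ax) => s; rewrite /= in_itv /= => /andP[s0 sL].
  apply: filterE => n.
  have [_ _ [g0 _ /(_ 0 s (lexx _) s0 (le_trans sL (Ll n)))[_ As]]] := gP n.
  by rewrite g0 subr0.
have hle s t : 0 <= s -> s <= t -> t <= L -> K (h s) (h t) <= t - s.
  move=> s0 st tL.
  have [As gs] : A (h s) /\ g n s @[n --> F] --> h s.
    by apply: hP; rewrite /= in_itv /= s0 (le_trans st).
  have [At gt] : A (h t) /\ g n t @[n --> F] --> h t.
    by apply: hP; rewrite /= in_itv /= tL (le_trans s0).
  apply: (cvgr_to_le (cvg_metric _ As At gs gt)); apply: filterE => n.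
  by have [_ _ [_ _ /(_ s t s0 st (le_trans tL (Ll n)))[]]] := gP n.
have [Ah0 h0] : A (h 0) /\ g n 0 @[n --> F] --> h 0 by apply: hP; rewrite /= in_itv /= lexx.
have [AhL hL] : A (h L) /\ g n L @[n --> F] --> h L by apply: hP; rewrite /= in_itv /= lexx L0.
have h0E : h 0 = x.
  apply: metric_eq0 => //; apply/eqP; rewrite eq_le metric_ge0// andbT.
  have c : K (g n 0) x @[n --> F] --> K (h 0) x.
    by apply: cvg_metric => //; exact: cvg_cst.
  apply: (cvgr_to_le c); apply: filterE => n.
  by have [_ _ [-> _ _]] := gP n; rewrite metric_refl.
have hLE : h L = y.
  apply: metric_eq0 => //; apply/eqP; rewrite eq_le metric_ge0// andbT.
  apply/ler_addgt0Pl => e e0; rewrite addr0.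
  have c : K (g n L) y @[n --> F] --> K (h L) y.
    by apply: cvg_metric => //; exact: cvg_cst.
  apply: (cvgr_to_le c).
  have := near_infty_natSinv_lt (PosNum e0) => /Foo; apply: filterS => n /= ne.
  have [l0 lL [_ gl /(_ L (l n) L0 (Ll n) (lexx _))[_ _]]] := gP n.
  by rewrite gl => /le_trans; apply; rewrite lerBlDl ltW// (lt_trans lL)// ltrD2l.
(* The upper bounds on [[0, s]], [[s, t]] and [[t, L]] add up to [L = K x y], so by the triangle
   inequality none of them is strict. *)
have hE s t : 0 <= s -> s <= t -> t <= L -> K (h s) (h t) = t - s.
  move=> s0 st tL; apply/eqP; rewrite eq_le hle//=.
  have sL := le_trans st tL; have t0 := le_trans s0 st.
  have [As _] : A (h s) /\ g n s @[n --> F] --> h s.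
    by apply: hP; rewrite /= in_itv /= s0.
  have [At _] : A (h t) /\ g n t @[n --> F] --> h t.
    by apply: hP; rewrite /= in_itv /= tL t0.
  have := hle 0 s (lexx 0) s0 sL; have := hle t L t0 tL (lexx L).
  have := metric_triangle Ax As Ay; have := metric_triangle As At Ay.
  by rewrite h0E hLE -/L; lra.
exists h; split=> // s t Is It; split; first by case: (hP _ Is).
move: (Is) (It); rewrite /= !in_itv /= => /andP[s0 sL] /andP[t0 tL].
have [st|/ltW ts] := leP s t; first by rewrite hE// distrC ger0_norm// subr_ge0.
have [As _] := hP _ Is; have [At _] := hP _ It.
by rewrite (metric_sym As At) hE// ger0_norm// subr_ge0.
Qed.

End MetricGeometry.

(** * The topology of the Kobayashi distance *)

Section RealNorm.
Context {R : realType} {V : normedModType (Cplx R)}.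
Implicit Types (x y v : V) (r e : R).

Definition rnorm v : R := complex.Re `|v|.

Lemma norm_rnorm v : `|v| = (rnorm v)%:C%C :> Cplx R.
Proof. by rewrite /rnorm RRe_real// normr_real. Qed.

Lemma rnorm_ge0 v : 0 <= rnorm v.
Proof. by have := normr_ge0 v; rewrite norm_rnorm ler0c. Qed.

Lemma rnorm0 : rnorm 0 = 0.
Proof. by rewrite /rnorm normr0. Qed.

Lemma rnormZ (a : Cplx R) v : rnorm (a *: v) = cmod a * rnorm v.
Proof.
apply: (@complexI R); rewrite rmorphM /= -norm_cmod -!norm_rnorm.
exact: normrZ.
Qed.

Lemma rnormB x y : rnorm (x - y) = rnorm (y - x).
Proof. by rewrite /rnorm distrC. Qed.

Lemma rnorm_dist x y : `|rnorm x - rnorm y| <= rnorm (x - y).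
Proof.
rewrite -lecR -norm_rnorm -cmod_real -norm_cmod rmorphB /= -!norm_rnorm.
exact: ler_dist_dist.
Qed.

Lemma nbhs_rnormP x (A : set V) : nbhs x A <->
  exists2 e, 0 < e & forall y, rnorm (y - x) < e -> A y.
Proof.
split=> [/nbhs_normP[e /= e0 eA]|[e e0 eA]].
  have eE : e = (complex.Re e)%:C%C by rewrite RRe_real// gtr0_real.
  exists (complex.Re e); first by move: e0; rewrite eE ltcR.
  by move=> y xy; apply: eA; rewrite /= distrC norm_rnorm eE ltcR.
apply/nbhs_normP; exists e%:C%C; first by rewrite /= ltcR.
by move=> y /=; rewrite distrC norm_rnorm ltcR; exact: eA.
Qed.

Lemma rnorm_continuous : continuous (rnorm : V -> R).
Proof.
move=> x; apply/cvgrPdist_lt => e e0; apply/nbhs_rnormP; exists e => // y xy.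
by apply: le_lt_trans (rnorm_dist _ _) _; rewrite rnormB.
Qed.

Lemma continuous_rnorm_dist x : continuous (fun y => rnorm (y - x)).
Proof.
move=> y; apply: (@continuous_comp _ _ _ (fun y => y - x) rnorm).
  by apply: (@cvgB _ _ _ (nbhs y)) => //; exact: cvg_cst.
exact: rnorm_continuous.
Qed.

Lemma derivable_affine x v (z : Cplx R) :
  derivable (fun z : Cplx R => x + z *: v) z 1.
Proof.
apply/cvg_ex; exists v; apply: cvg_near_cst.
near=> h; have h0 : h != 0 by near: h; exact: nbhs_dnbhs_neq.
rewrite /= opprD addrACA subrr add0r -scalerBl scalerA addrK.
by rewrite -[h%:A]/(h * 1) mulr1 mulVf// scale1r.
Unshelve. all: by end_near. Qed.

End RealNorm.

(** * Heine-Borel for complex row vectors *)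

Section HeineBorel.
Context {R : realType}.

Lemma compact_csquare (M : R) :
  compact [set z : Cplx R | `|complex.Re z| <= M /\ `|complex.Im z| <= M].
Proof.
have -> : [set z : Cplx R | `|complex.Re z| <= M /\ `|complex.Im z| <= M] =
   (fun ab : R * R => ab.1%:C%C + 'i%C * ab.2%:C%C : Cplx R) @` (`[-M, M] `*` `[-M, M]).
  apply/seteqP; split=> [z [zr zi]|_ [[a b] /= [ha hb] <-]].
    exists (complex.Re z, complex.Im z); last by rewrite /= -complexE.
    by split; rewrite /= in_itv /= -ler_norml.
  move: ha hb; rewrite !in_itv /= -!ler_norml.
  by split; rewrite ?(mul0r, mulr0, mul1r, subr0, addr0, add0r).
apply: continuous_compact; last by apply: compact_setX; exact: segment_compact.
apply: continuous_subspaceT => ab.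
apply: (@cvgD _ _ _ (nbhs ab)); last apply: (@cvgM _ _ (nbhs ab)).
- apply: (@continuous_comp _ _ _ fst); first exact: cvg_fst.
  exact: continuous_real_complex.
- exact: cvg_cst.
- apply: (@continuous_comp _ _ _ snd); first exact: cvg_snd.
  exact: continuous_real_complex.
Qed.

Lemma Re_Im_le_cmod (z : Cplx R) :
  `|complex.Re z| <= cmod z /\ `|complex.Im z| <= cmod z.
Proof.
have h := sqr_cmod z; have z0 := cmod_ge0 z.
split; rewrite -(@ler_pXn2r _ 2)// ?nnegrE// h real_normK ?num_real//.
  by rewrite lerDl sqr_ge0.
by rewrite lerDr sqr_ge0.
Qed.

Lemma cmod_coord_le d (v : 'C[R]^d) i : cmod (v ord0 i) <= rnorm v.
Proof.
rewrite -lecR -norm_cmod -norm_rnorm [leRHS]/Num.norm /= mx_normE.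
by rewrite -[leLHS]nngE num_le; apply: (le_bigmax _ _ (ord0, i)).
Qed.

Lemma bounded_closed_compactC d (A : set 'C[R]^d) (M : R) :
  (forall v, A v -> rnorm v <= M) -> closed A -> compact A.
Proof.
move=> AM cA.
apply: subclosed_compact cA (rV_compact (fun=> @compact_csquare M)) _.
move=> v /AM vM i.
have [h1 h2] := Re_Im_le_cmod (v ord0 i); have h3 := cmod_coord_le v i.
by split; [apply: (le_trans h1)|apply: (le_trans h2)]; apply: (le_trans h3).
Qed.

End HeineBorel.

(** * Agreement of the Kobayashi and Euclidean topologies *)

Section KobayashiTopology.
Context {R : realType} {d : nat} (Omega : set 'C[R]^d).
Implicit Types (x y : 'C[R]^d) (r e : R).
Local Notation K := (kobayashi Omega).

Hypothesis Omega_open : open Omega.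
Hypothesis metricK : metric_on Omega K.

(* The affine disc z |-> x + z / tanh e * (y - x) stays in Omega and joins x to
   y between points at distance e. *)
Lemma kobayashi_small x e : Omega x -> 0 < e ->
  exists2 r, 0 < r & forall y, rnorm (y - x) < r -> Omega y /\ K x y <= e.
Proof.
move=> Ox e0; have s0 := tanhR_gt0 e0; set s := tanhR e in s0 *.
have s1 : s < 1 by have := tanhR_lt1 e; rewrite ger0_norm// ltW.
have /nbhs_rnormP[r r0 rO] : nbhs x Omega by exact: open_nbhs_nbhs.
(* With this radius [v] below has norm less than [r], so the whole affine disc stays within [r] of
   [x]. *)
exists (r * s); first by rewrite mulr_gt0.
move=> y yr; split.
  by apply: rO; apply: lt_trans yr _; rewrite gtr_pMr.
pose v := (s^-1)%:C%C *: (y - x).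
have d0 : unit_disc (0 : Cplx R) by rewrite /unit_disc /= /cmod normr0.
have ds : unit_disc (s%:C%C : Cplx R) by rewrite /unit_disc /= cmod_real gtr0_norm.
have fh : holomorphic_disc Omega (fun z : Cplx R => x + z *: v).
  move=> z z1; split; first exact: derivable_affine.
  apply: rO; rewrite addrC addKr !rnormZ cmod_real gtr0_norm ?invr_gt0//.
  rewrite mulrCA ltr_pdivrMl// (mulrC s).
  apply: le_lt_trans yr; rewrite ler_piMl ?rnorm_ge0//; exact: ltW.
have := disc_chain1 fh d0 ds.
rewrite scale0r addr0 /v scalerA -(rmorphM (real_complex R)) mulfV ?gt_eqF//.
rewrite scale1r addrC subrK => /kobayashi_le; congr (_ <= _).
rewrite poincare_distE /pseudo_dist sub0r mulr0 subr0 divr1 cmodN cmod_real.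
have := @poincare_dist_tanhR R 0 e (ltW e0).
by rewrite tanhR0 sub0r mulr0 !subr0 divr1 normrN.
Qed.

(* The infimum is never taken over the empty set: its junk value 0 would force
   x = y, and the constant disc is a chain from x to x. *)
Lemma kobayashi_chain x y e : Omega x -> Omega y -> 0 < e ->
  exists2 l, disc_chain Omega x y l & l < K x y + e.
Proof.
move=> Ox Oy e0; have [ne|ne] := pselect ([set l | disc_chain Omega x y l] !=set0).
  by apply: inf_adherent => //; split => //; exists 0 => l /disc_chain_ge0.
have xy : x = y.
  apply: (metric_eq0 metricK) => //; rewrite /kobayashi (_ : [set _ | _] = set0) ?inf0//.
  by rewrite -subset0 => l c; apply: ne; exists l.
have : disc_chain Omega x y 0 by rewrite -xy; exact: disc_chain_refl.
by move=> c; exists 0 => //; rewrite ltr_wpDl// kobayashi_ge0.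
Qed.

Lemma kobayashi_length : length_metric Omega K.
Proof.
move=> x y e Ox Oy e0; have [l c le] := kobayashi_chain Ox Oy e0.
have [g [g0 gl _ gs]] := disc_chain_path c.
exists l, g; split=> //; first exact: disc_chain_ge0 c.
split=> // s t s0 st tl; have [? ? ?] := gs _ _ s0 st tl.
by split=> //; exact: kobayashi_le.
Qed.

Lemma compact_sphere x r : compact [set y | rnorm (y - x) = r].
Proof.
apply: (@bounded_closed_compactC _ _ _ (r + rnorm x)).
  move=> y /= <-; have := rnorm_dist y x; rewrite ler_norml => /andP[_].
  by rewrite lerBlDr.
apply: (@closed_comp _ _ (fun y => rnorm (y - x)) [set r]); last exact: closed_eq.
by move=> y _; exact: continuous_rnorm_dist.
Qed.

(* A chain of discs leaving a small sphere around x meets the sphere, on which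
   K x is bounded below by compactness; this replaces the Schwarz lemma. *)
Lemma kobayashi_nbhs : metric_nbhs Omega K.
Proof.
move=> x Ox V; split=> [xV|[e e0 eV]]; last first.
  have [r r0 rK] := kobayashi_small Ox (divr_gt0 e0 (ltr0Sn _ 1)).
  apply/nbhs_rnormP; exists r => // y /rK[Oy Kxy]; apply: eV => //.
  by apply: le_lt_trans Kxy _; lra.
have /nbhs_rnormP[r r0 rVO] : nbhs x (V `&` Omega).
  by apply: filterI => //; exact: open_nbhs_nbhs.
pose e := r / 2; have e0 : 0 < e by rewrite divr_gt0.
have er : e < r by rewrite /e; lra.
pose S := [set y | rnorm (y - x) = e].
have SO : S `<=` Omega by move=> y Sy; have [] := rVO y; rewrite ?Sy.
(* Only the upper bound of [kobayashi_small] and the triangle inequality enter here, as the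
   equivalence being proved is not yet available. *)
have cK : {within S, continuous (K x)}.
  apply/subspace_continuousP => y /SO Oy.
  apply: cvg_within_filter; apply/cvgrPdist_lt => f f0.
  have [s s0 sK] := kobayashi_small Oy (divr_gt0 f0 (ltr0Sn _ 1)).
  apply/nbhs_rnormP; exists s => // z /sK[Oz Kyz].
  have := metric_triangle metricK Ox Oy Oz; have := metric_triangle metricK Ox Oz Oy.
  rewrite (metric_sym metricK Oz Oy) ltr_norml; lra.
have /compact_closed : compact (K x @` S).
  by apply: continuous_compact cK _; exact: compact_sphere.
move=> /(_ (@Rhausdorff R)) /closed_openC oC.
have C0 : (~` (K x @` S)) 0.
  move=> [y Sy] /(metric_eq0 metricK Ox (SO _ Sy)) xy.
  by move: Sy e0; rewrite /S /= -xy subrr rnorm0 => ->; rewrite ltxx.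
have /nbhs_normP[f /= f0 fC] : nbhs (0 : R) (~` (K x @` S)) by exact: open_nbhs_nbhs.
exists f => // y Oy Kf.
have [|l c lf] := @kobayashi_chain x y (f - K x y) Ox Oy; first by rewrite subr_gt0.
rewrite addrC subrK in lf.
have [g [g0 gl gc gs]] := disc_chain_path c; have l0 := disc_chain_ge0 c.
have cI : connected ((fun z => rnorm (z - x)) @` (g @` `[0, l])).
  apply: connected_continuous_connected gc _; apply: continuous_subspaceT.
  exact: continuous_rnorm_dist.
have [] := rVO y; last by [].
rewrite ltNge; apply/negP => ry.
(* Along the path the distance to [x] takes the value 0 and one that is at least [r], hence also
   [e]. At such a time [t], [K x (g t) <= t <= l < f], whereas [f] was chosen so that [K x] has no
   value below [f] on [S]. *)
have /connected_intervalP/(_ 0 (rnorm (y - x))) := cI.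
move=> /(_ _ _ e)[].
- exists x; last by rewrite subrr rnorm0.
  by exists 0 => //; rewrite /= in_itv /= lexx.
- by exists y => //; exists l => //; rewrite /= in_itv /= lexx l0.
- by rewrite ltW//= (le_trans (ltW er)).
move=> z [t]; rewrite /= in_itv /= => /andP[t0 tl] <- re.
have [_ _ ct] := gs 0 t (lexx _) t0 tl.
have := fC (K x (g t)); rewrite /= sub0r normrN ger0_norm ?kobayashi_ge0//.
move: ct; rewrite subr0 g0 => /kobayashi_le Kt.
by case; [apply: le_lt_trans Kt (le_lt_trans tl lf)|exists (g t)].
Qed.

Lemma kobayashi_locally_compact x : Omega x ->
  exists2 e, 0 < e & compact (kball Omega K x e).
Proof.
move=> Ox; have /nbhs_rnormP[r r0 rO] : nbhs x Omega by exact: open_nbhs_nbhs.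
pose C := [set y | rnorm (y - x) <= r / 2].
have CO : C `<=` Omega by move=> y Cy; apply: rO; apply: le_lt_trans Cy _; lra.
have cC : compact C.
  apply: (@bounded_closed_compactC _ _ _ (r / 2 + rnorm x)).
    move=> y Cy; have := rnorm_dist y x; rewrite ler_norml lerBlDr => /andP[_].
    by move=> h; apply: (le_trans h); rewrite lerD2r.
  apply: (@closed_comp _ _ (fun y => rnorm (y - x)) [set s | s <= r / 2]);
    last exact: closed_le.
  by move=> y _; exact: continuous_rnorm_dist.
have xC : nbhs x C.
  by apply/nbhs_rnormP; exists (r / 2); [rewrite divr_gt0|move=> y /ltW].
have /(kobayashi_nbhs Ox)[e e0 eC] := xC.
exists (e / 2); first by rewrite divr_gt0.
apply: (compact_subkball metricK kobayashi_nbhs Ox cC CO) => y [Oy Ky].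
by apply: eC => //; apply: le_lt_trans Ky _; lra.
Qed.

End KobayashiTopology.

(** * Ends of limits of geodesic segments *)

(** Reversing time lets one study of the end at [+oo] serve for both ends. *)
Lemma cluster_ninftyE (R : realType) (d : nat) (Omega : set 'C[R]^d) (h : R -> 'C[R]^d) :
  cluster_ninfty Omega h = cluster_pinfty Omega (h \o -%R).
Proof.
rewrite /cluster_ninfty /cluster_pinfty; congr (_ `&` cluster _).
rewrite -ninftyN -fmap_comp; congr (_ @ -oo).
by apply/funext => t /=; rewrite opprK.
Qed.

Section VisibleDomain.
Context {R : realType} {d : nat} (Omega : set 'C[R]^d).
Implicit Types (x y o p q : 'C[R]^d) (r s t e M D : R).
Local Notation K := (kobayashi Omega).

Hypothesis Omega_open : open Omega.
Hypothesis Omega_bounded : bounded_set Omega.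
Hypothesis Omega_complete : complete_metric_on Omega K.

Let metricK : metric_on Omega K. Proof. by case: Omega_complete. Qed.
Let nbhsK : metric_nbhs Omega K. Proof. exact: kobayashi_nbhs. Qed.
Let lengthK : length_metric Omega K. Proof. exact: kobayashi_length. Qed.

Lemma boundary_notin p : boundary Omega p -> ~ Omega p.
Proof. by move=> [_ pO] Op; apply: pO; exact: open_nbhs_nbhs. Qed.

Lemma compact_closure_domain : compact (closure Omega).
Proof.
have [M [Mr MO]] := Omega_bounded.
have MM : M < `|M| + 1 by rewrite (le_lt_trans (real_ler_norm Mr))// ltrDl.
(* [bounded_set] bounds the norms by any number of [Cplx R] strictly above the real [M], hence by
   [|M| + 1]. *)
pose N := complex.Re (`|M| + 1).
have cN : closed [set v : 'C[R]^d | rnorm v <= N].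
  by apply: (@closed_comp _ _ rnorm [set s | s <= N]) => [v _|];
    [exact: rnorm_continuous|exact: closed_le].
have ON : Omega `<=` [set v | rnorm v <= N].
  move=> v Ov; rewrite /= -lecR -norm_rnorm /N RRe_real ?realD//.
  exact: (MO _ MM).
apply: (@bounded_closed_compactC _ _ _ N); last exact: closed_closure.
by move=> v /(closureS ON); rewrite -(closure_id _).1.
Qed.

Lemma compact_kobayashi_ball o r : Omega o -> compact (kball Omega K o r).
Proof.
move=> Oo; apply: compact_kball => //; first by case: Omega_complete.
exact: kobayashi_locally_compact.
Qed.

Lemma kobayashi_bounded_on_compact (C : set 'C[R]^d) o : Omega o -> compact C ->
  C `<=` Omega -> exists D, forall y, C y -> K o y <= D.
Proof.
move=> Oo cC CO.
have cK : {within C, continuous (K o)}.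
  apply/subspace_continuousP => y /CO Oy; apply: cvg_within_filter.
  exact: (metricr_continuous metricK nbhsK).
have [M [_ MC]] := compact_bounded (continuous_compact cK cC).
exists (M + 1) => y Cy; apply: le_trans (ler_norm _) _.
by apply: MC; [rewrite ltrDl|exists y].
Qed.

(** Closed Kobayashi balls are compact, hence closed in the ambient space, so [p] outside Omega has
    a neighbourhood avoiding the one of radius [M]. *)
Lemma kobayashi_escape (F : set_system nat) (x : nat -> 'C[R]^d) o p M :
  Filter F -> Omega o -> ~ Omega p -> x @ F --> p -> (forall n, Omega (x n)) ->
  \forall n \near F, M < K o (x n).
Proof.
move=> FF Oo Op xp Ox.
have cB : closed (kball Omega K o M).
  by apply: compact_closed; [exact: norm_hausdorff|exact: compact_kobayashi_ball].
have pB : nbhs p (~` kball Omega K o M).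
  by apply: open_nbhs_nbhs; split; [exact: closed_openC|case].
have FB : \forall n \near F, (~` kball Omega K o M) (x n) := xp _ pB.
apply: filterS FB => n /= nB; rewrite ltNge; apply/negP => h; exact: nB.
Qed.

Lemma isometric_geodesic (I : set R) g : is_interval I ->
  isometric_on Omega K I g -> geodesic Omega I g.
Proof.
move=> iI gI; split=> //; first exact: (isometric_continuous nbhsK gI).
  by move=> t It; have [] := gI _ _ It It.
by move=> s t Is It; have [] := gI _ _ Is It.
Qed.

Lemma isometric_sub (I J : set R) g : I `<=` J ->
  isometric_on Omega K J g -> isometric_on Omega K I g.
Proof. by move=> IJ gJ s t /IJ Js /IJ Jt; exact: gJ. Qed.

(** * One end of a limit of geodesic segments *)

Section Ends.
Variables (F : set_system nat) (g : nat -> R -> 'C[R]^d) (b : nat -> R).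
Variables (o p : 'C[R]^d) (M : R).
Hypothesis FU : UltraFilter F.
Hypothesis Oo : Omega o.
Hypothesis Op : boundary Omega p.
Hypothesis b0 : forall n, 0 <= b n.
Hypothesis g_iso : forall n, isometric_on Omega K `[0, b n] (g n).
Hypothesis g_near : \forall n \near F, K o (g n 0) <= M.
Hypothesis g_end : g n (b n) @[n --> F] --> p.

Let g0 n : Omega (g n 0).
Proof. by have [] := @g_iso n 0 0; rewrite //= in_itv /= lexx b0. Qed.

Let gb n : Omega (g n (b n)).
Proof. by have [] := @g_iso n (b n) (b n); rewrite //= in_itv /= lexx b0. Qed.

Let g_dist n s : 0 <= s -> s <= b n -> Omega (g n s) /\ K (g n 0) (g n s) = s.
Proof.
move=> s0 sb.
have I0 : `[0, b n]%classic 0 by rewrite /= in_itv /= lexx b0.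
have Is : `[0, b n]%classic s by rewrite /= in_itv /= s0.
have [_ ->] := g_iso I0 Is; have [Os _] := g_iso Is Is.
by rewrite sub0r normrN ger0_norm.
Qed.

(** The end points go beyond distance [M + T] from [o] while the starting points stay within [M]. *)
Lemma isometric_end_length T : \forall n \near F, T < b n.
Proof.
have far : \forall n \near F, M + T < K o (g n (b n)).
  exact: kobayashi_escape (boundary_notin Op) g_end gb.
apply: filterS2 g_near far => n gM gT.
have [_ Kb] := g_dist (b0 n) (lexx _).
by have := metric_triangle metricK Oo (g0 n) (gb n); rewrite Kb; lra.
Qed.

Lemma isometric_end_dist n t : K o (g n 0) <= M -> 0 <= t -> t <= b n ->
  t - M <= K o (g n t).
Proof.
move=> gM t0 tb; have [Ot Kt] := g_dist t0 tb.
have := metric_triangle metricK (g0 n) Oo Ot.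
by rewrite Kt (metric_sym metricK (g0 n) Oo); lra.
Qed.

Hypothesis Omega_visible : visible Omega.
Variable h : R -> 'C[R]^d.
Hypothesis h_lim : forall t, 0 <= t -> Omega (h t) /\ g n t @[n --> F] --> h t.

(** Makes [h] leave every Kobayashi ball, so that it can accumulate at infinity only on the
    boundary. *)
Lemma ultralimit_end_dist t : 0 <= t -> t - M <= K o (h t).
Proof.
move=> t0; have [Ot gt] := h_lim t0.
have Ko : K o (g n t) @[n --> F] --> K o (h t).
  exact: (@cvg_metricr _ _ _ _ metricK nbhsK _ F (g ^~ t) _ _ _ Oo Ot gt).
apply: (cvgr_to_ge Ko); apply: filterS2 g_near (isometric_end_length t) => n gM tb.
by apply: isometric_end_dist => //; exact: ltW.
Qed.

Lemma ultralimit_end_unique q :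
  closure Omega q -> cluster (h t @[t --> +oo]) q -> q = p.
Proof.
move=> cq hq.
have meet T (V : set 'C[R]^d) : nbhs q V ->
    exists t, [/\ 0 <= t, T < t & V (h t)].
  move=> qV; have FT : (h t @[t --> +oo]) (h @` [set t | 0 <= t /\ T < t]).
    exists (Num.max 0 T); split; first exact: num_real.
    by move=> t; rewrite gt_max => /andP[t0 Tt]; exists t => //; split=> //; exact: ltW.
  by have [_ [[t [t0 Tt] <-] Vt]] := hq _ _ FT qV; exists t.
(* Otherwise [h t] would be within 1 of [q] at some time [t > M + K o q + 1], against
   [t - M <= K o (h t)]. *)
have Oq : ~ Omega q.
  move=> Oq; have [t [t0 Tt [Ot Kt]]] :=
    meet (M + K o q + 1) _ (nbhs_metric_ball nbhsK Oq ltr01).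
  have := metric_triangle metricK Oo Oq Ot; have := ultralimit_end_dist t0; lra.
have bq : boundary Omega q by split=> // /interior_subset.
apply: contrapT => qp.
have [Vq [Vp [C [[nVq nVp _ cC CO] vis]]]] := Omega_visible bq Op qp.
have [D CD] := kobayashi_bounded_on_compact Oo cC CO.
(* After time [M + D] the segments are farther than [D] from [o], hence off [C]. With [h t] in the
   interior of [Vq], the nearby points [g n t] are in [Vq]. *)
have [t [t0 Tt Vt]] := meet (M + D) _ (nbhs_interior nVq).
have [Ot gt] := h_lim t0.
have near_t : \forall n \near F, [/\ K o (g n 0) <= M, t < b n, Vq (g n t) & Vp (g n (b n))].
  have Vq_near : \forall n \near F, Vq (g n t) := gt _ Vt.
  have Vp_near : \forall n \near F, Vp (g n (b n)) := g_end nVp.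
  apply: filterS3 (filterI g_near (isometric_end_length t)) Vq_near Vp_near.
  by move=> n [].
have [n [gM tb Vqt Vpb]] := filter_ex near_t.
have tb' := ltW tb.
have seg : geodesic_segment Omega t (b n) (g n).
  split; first exact: tb'.
  apply: isometric_geodesic; first exact: interval_is_interval.
  apply: isometric_sub (@g_iso n) => s /=; rewrite !in_itv /= => /andP[ts ->].
  by rewrite (le_trans t0).
have [s] := vis t (b n) (g n) seg (conj Vqt (g_dist t0 tb').1) (conj Vpb (gb n)).
rewrite in_itv /= => /andP[ts sb] Cs.
by have := isometric_end_dist gM (le_trans t0 ts) sb; have := CD _ Cs; lra.
Qed.

(** Compactness of the closure provides a cluster point, which can only be [p]. *)
Lemma ultralimit_end_cluster : cluster_pinfty Omega h = [set p].
Proof.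
apply/seteqP; split=> [q [cq hq]|q ->]; first exact: ultralimit_end_unique hq.
have hO : (h t @[t --> +oo]) (closure Omega).
  exists 0; split; first exact: num_real.
  by move=> t t0; apply: subset_closure; exact: (h_lim (ltW t0)).1.
have [q' [cq hq]] := compact_closure_domain (fmap_proper_filter h _) hO.
by rewrite -(ultralimit_end_unique cq hq).
Qed.

End Ends.

(** * From anchored segments to a loop *)

Hypothesis Omega_visible : visible Omega.

(** Each segment is split at its anchor [s n] into a forward half [gf] and a backward half [gb].
    Along [F] both start within [M] of [o] and end at points tending to [p], so the two ends of the
    limit line fall under the same study. *)
Lemma anchored_segments_loop (F : set_system nat) (g : nat -> R -> 'C[R]^d)
    (l s : nat -> R) o p M : UltraFilter F -> Omega o -> boundary Omega p ->
  (forall n, 0 <= s n /\ s n <= l n) ->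
  (forall n, isometric_on Omega K `[0, l n] (g n)) ->
  g n 0 @[n --> F] --> p -> g n (l n) @[n --> F] --> p ->
  (\forall n \near F, K o (g n (s n)) <= M) ->
  exists h, geodesic_loop Omega h /\ loop_vertex Omega h = [set p].
Proof.
move=> FU Oo bp sl g_iso g0 gl gM.
pose gf n t := g n (s n + t); pose gb n t := g n (s n - t).
have gf_iso n : isometric_on Omega K `[0, l n - s n] (gf n).
  have [s0 _] := sl n.
  move=> t u; rewrite /= !in_itv /= => /andP[t0 tl] /andP[u0 ul].
  have [||Ot Kt] := g_iso n (s n + t) (s n + u).
  - by rewrite /= in_itv /= addr_ge0// -lerBrDl.
  - by rewrite /= in_itv /= addr_ge0// -lerBrDl.
  by split=> //; rewrite Kt; congr `|_|; ring.
have gb_iso n : isometric_on Omega K `[0, s n] (gb n).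
  have [s0 sln] := sl n.
  move=> t u; rewrite /= !in_itv /= => /andP[t0 ts] /andP[u0 us].
  have [||Ot Kt] := g_iso n (s n - t) (s n - u).
  - by rewrite /= in_itv /= subr_ge0 ts (le_trans _ sln)// gerBl.
  - by rewrite /= in_itv /= subr_ge0 us (le_trans _ sln)// gerBl.
  by split=> //; rewrite Kt distrC; congr `|_|; ring.
have lf0 n : 0 <= l n - s n by have [] := sl n; rewrite subr_ge0.
have lb0 n : 0 <= s n by have [] := sl n.
have gfM : \forall n \near F, K o (gf n 0) <= M by under eq_near do rewrite /gf addr0.
have gbM : \forall n \near F, K o (gb n 0) <= M by under eq_near do rewrite /gb subr0.
have gfp : gf n (l n - s n) @[n --> F] --> p.
  by under eq_fun do rewrite /gf addrC subrK.
have gbp : gb n (s n) @[n --> F] --> p.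
  by under eq_fun do rewrite /gb subrr.
(* For a fixed time [t], both [s n + t] and [s n - t] belong to the domain of [g n] for almost all
   [n] along [F]. *)
have long t : \forall n \near F, `|t| <= l n - s n /\ `|t| <= s n.
  apply: filterS2 (isometric_end_length FU Oo bp lf0 gf_iso gfM gfp `|t|)
    (isometric_end_length FU Oo bp lb0 gb_iso gbM gbp `|t|) => n tl ts.
  by split; exact: ltW.
have in_seg n t : `|t| <= l n - s n /\ `|t| <= s n -> `[0, l n]%classic (s n + t).
  move=> [tl ts]; rewrite /= in_itv /=; move: tl ts; rewrite !ler_norml; lra.
have [h hP] : exists h : R -> 'C[R]^d, forall t, setT t ->
    Omega (h t) /\ gf n t @[n --> F] --> h t.
  apply: (@ultralimit_path _ _ _ _ metricK nbhsK lengthK Omega_complete.2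
    (kobayashi_locally_compact Omega_open metricK) F setT gf o (fun t => M + `|t|)) => // t _.
  apply: filterS2 gM (long t) => n gsM tn.
  have Is : `[0, l n]%classic (s n) by rewrite /= in_itv /= (sl n).1 (sl n).2.
  have It := in_seg n t tn.
  have [Os _] := g_iso n _ _ Is Is; have [Ot _] := g_iso n _ _ It It.
  have [_] := g_iso n _ _ Is It; rewrite opprD addNKr normrN => Kt.
  by split=> //; have := metric_triangle metricK Oo Os Ot; rewrite Kt /gf; lra.
have hO t : Omega (h t) by have [] := hP t I.
have h_lim t : gf n t @[n --> F] --> h t by have [] := hP t I.
have h_iso : isometric_on Omega K setT h.
  move=> t u _ _; split=> //.
  have Ktu : K (gf n t) (gf n u) @[n --> F] --> K (h t) (h u).
    exact: (@cvg_metric _ _ _ _ metricK nbhsK _ F (gf ^~ t) (gf ^~ u) _ _ _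
      (hO t) (hO u) (h_lim t) (h_lim u)).
  have near_tu : \forall n \near F, K (gf n t) (gf n u) = `|t - u|.
    apply: filterS2 (long t) (long u) => n tn un.
    have [_ ->] := g_iso n _ _ (in_seg _ _ tn) (in_seg _ _ un).
    by congr `|_|; ring.
  by apply/eqP; rewrite eq_le; apply/andP; split;
    [apply: (cvgr_to_le Ktu)|apply: (cvgr_to_ge Ktu)]; apply: filterS near_tu => n ->.
have hT : geodesic_line Omega h.
  by apply: isometric_geodesic h_iso => u v _ _ w _.
exists h.
have hp : cluster_pinfty Omega h = [set p].
  exact: (ultralimit_end_cluster FU Oo bp lf0 gf_iso gfM gfp Omega_visible
    (fun t _ => hP t I)).
have hn : cluster_ninfty Omega h = [set p].
  (* [gb n t] is [gf n (- t)] by conversion, so the backward halves tend to [h] with time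
     reversed. *)
  rewrite cluster_ninftyE.
  exact: (ultralimit_end_cluster FU Oo bp lb0 gb_iso gbM gbp Omega_visible
    (fun t _ => hP (- t) I)).
split; last exact: hp.
by split; [exact: hT|rewrite hp hn].
Qed.

(** A segment staying in [U] would be a connected subset of the intersection with Omega, and its
    ends would share a component. *)
Lemma segment_leaves_nbhd (U : set 'C[R]^d) x y l g : 0 <= l -> g 0 = x -> g l = y ->
  isometric_on Omega K `[0, l] g ->
  connected_component (U `&` Omega) x <> connected_component (U `&` Omega) y ->
  exists2 t, 0 <= t /\ t <= l & ~ U (g t).
Proof.
move=> l0 g0 gl g_iso xy; apply: contrapT => nU.
have gU t : `[0, l]%classic t -> (U `&` Omega) (g t).
  move=> It; split; last by have [] := g_iso _ _ It It.
  apply: contrapT => Ut; apply: nU; exists t => //.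
  by move: It; rewrite /= in_itv /= => /andP[].
have gc : connected (g @` `[0, l]).
  apply: connected_continuous_connected; first exact: segment_connected.
  exact: (isometric_continuous nbhsK g_iso).
apply: xy; apply: same_connected_component.
apply: (@connected_component_max _ _ (g @` `[0, l])) => //.
- by exists 0 => //; rewrite /= in_itv /= lexx.
- by move=> _ [t It <-]; exact: gU.
- by exists l => //; rewrite /= in_itv /= lexx l0.
Qed.

Lemma closure_cvg_seq (C : set 'C[R]^d) p : closure C p ->
  exists2 x : nat -> 'C[R]^d, (forall n, C (x n)) & x @ \oo --> p.
Proof.
move=> Cp; have /choice[x xP] : forall n, exists x, C x /\ rnorm (x - p) < n.+1%:R^-1.
  move=> n; have [|x [Cx xp]] := Cp [set x | rnorm (x - p) < n.+1%:R^-1].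
    by apply/nbhs_rnormP; exists n.+1%:R^-1 => //; rewrite invr_gt0.
  by exists x.
exists x => [n|V /nbhs_rnormP[e e0 eV]]; first by have [] := xP n.
have := near_infty_natSinv_lt (PosNum e0); apply: filterS => n /= ne.
by apply: eV; apply: lt_trans ne; have [] := xP n.
Qed.

End VisibleDomain.

(** * Segments between two components, anchored by visibility *)

Theorem proposition4p3 (R : realType) (d : nat) (Omega : set 'C[R]^d)
    (Omega_domain : domain Omega) (Omega_bounded : bounded_set Omega)
    (Omega_complete : complete_metric_on Omega (kobayashi Omega))
    (Omega_visible : visible Omega)
    (p : 'C[R]^d) (p_boundary : boundary Omega p)
    (U : set 'C[R]^d) (U_open : open U) (pU : U p)
    (two_components : exists C1 C2 : set 'C[R]^d,
       [/\ component_of (U `&` Omega) C1, component_of (U `&` Omega) C2,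
           C1 <> C2, closure C1 p & closure C2 p]) :
  exists g : R -> 'C[R]^d,
    geodesic_loop Omega g /\ loop_vertex Omega g = [set p].
Proof.
have [Oopen _ _] := Omega_domain; have [metricK completeK] := Omega_complete.
have nbhsK := kobayashi_nbhs Oopen metricK.
have [C1 [C2 [[c1 _ C1E] [c2 _ C2E] C12 C1p C2p]]] := two_components.
have [x xC1 xp] := closure_cvg_seq C1p; have [y yC2 yp] := closure_cvg_seq C2p.
have xC n : connected_component (U `&` Omega) (x n) = C1.
  by rewrite C1E; apply/esym/same_connected_component; rewrite -C1E.
have yC n : connected_component (U `&` Omega) (y n) = C2.
  by rewrite C2E; apply/esym/same_connected_component; rewrite -C2E.
have Ox n : Omega (x n).
  by have := xC1 n; rewrite C1E => /connected_component_sub[].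
have Oy n : Omega (y n).
  by have := yC2 n; rewrite C2E => /connected_component_sub[].
pose l n := kobayashi Omega (x n) (y n).
have l0 n : 0 <= l n by exact: kobayashi_ge0.
have /choice[g gP] : forall n, exists g : R -> 'C[R]^d,
    [/\ g 0 = x n, g (l n) = y n & isometric_on Omega (kobayashi Omega) `[0, l n] g].
  move=> n; apply: (exists_geodesic metricK nbhsK) => //.
    exact: kobayashi_length.
  exact: kobayashi_locally_compact.
have /choice[t tP] : forall n, exists t, (0 <= t /\ t <= l n) /\ ~ U (g n t).
  move=> n; have [g0 gl g_iso] := gP n.
  have [|t tl tU] := segment_leaves_nbhd Oopen Omega_complete (l0 n) g0 gl g_iso (U := U).
    by rewrite xC yC.
  by exists t.
have Ogt n : Omega (g n (t n)).
  have [[t0 tl] _] := tP n; have [_ _ g_iso] := gP n.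
  by have [] := g_iso (t n) (t n); rewrite /= ?in_itv /= ?t0.
have [F FU Foo] := exists_ultra_oo.
have xF : x @ F --> p by move=> V /xp /Foo.
have yF : y @ F --> p by move=> V /yp /Foo.
have [z cz tz] : exists2 z, closure Omega z & g n (t n) @[n --> F] --> z.
  apply: (ultra_cvg_compact FU (compact_closure_domain Omega_bounded)).
  by apply: filterE => n; exact: subset_closure.
(* Points outside the open set [U] have their limit outside [U]; this is what separates [z] from
   [p]. *)
have nUz : ~ U z.
  move=> Uz; have UF : \forall n \near F, U (g n (t n)) :=
    tz _ (open_nbhs_nbhs (conj U_open Uz)).
  by have [n] := filter_ex UF; case: (tP n).
suff: exists (o : 'C[R]^d) (M : R) (s : nat -> R), [/\ Omega o,
    forall n, 0 <= s n /\ s n <= l n & \forall n \near F, kobayashi Omega o (g n (s n)) <= M].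
  move=> [a [M [s [Oa sl sM]]]].
  apply: (anchored_segments_loop Oopen Omega_bounded Omega_complete Omega_visible
    FU Oa p_boundary sl _ _ _ sM).
  - by move=> n; have [] := gP n.
  - have -> : (fun n => g n 0) = x by apply/funext => n; have [-> _ _] := gP n.
    exact: xF.
  - have -> : (fun n => g n (l n)) = y by apply/funext => n; have [_ -> _] := gP n.
    exact: yF.
have [Oz|nOz] := pselect (Omega z).
  (* The exit points are themselves the anchors, eventually within 1 of their limit [z]. *)
  exists z, 1, t; split=> // [n|]; first by have [] := tP n.
  apply: filterS (cvg_dist0 nbhsK _ Oz tz ltr01) => n [_ /ltW].
  exact.
have bz : boundary Omega z by split=> // /interior_subset.
have pz : p <> z by move=> pz; apply: nUz; rewrite -pz.
have [Vp [Vz [C [[nVp nVz _ cC CO] vis]]]] := Omega_visible _ _ p_boundary bz pz.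
have [D CD] := kobayashi_bounded_on_compact Oopen Omega_complete (Ox 0%N) cC CO.
(* Visibility is applied to the piece from [x n] to the exit point when its ends lie in [Vp] and
   [Vz]; for the other [n] the exit time is a default value. *)
have /choice[s sP] : forall n, exists s, (0 <= s /\ s <= l n) /\
    (Vp (x n) -> Vz (g n (t n)) -> C (g n s)).
  move=> n; have [[t0 tl] _] := tP n; have [g0 gl g_iso] := gP n.
  have [[Vx Vt]|nV] := pselect (Vp (x n) /\ Vz (g n (t n))); last first.
    by exists (t n); split=> // Vx Vt; case: nV.
  have seg : geodesic_segment Omega 0 (t n) (g n).
    split; first exact: t0.
    apply: (isometric_geodesic Oopen Omega_complete); first exact: interval_is_interval.
    apply: isometric_sub g_iso => s; rewrite /= !in_itv /= => /andP[-> /le_trans]; exact.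
  have [||s] := vis 0 (t n) (g n) seg; [by rewrite g0; split|by split|].
  rewrite in_itv /= => /andP[s0 st] Cs; exists s; split=> //; split=> //.
  exact: le_trans st tl.
exists (x 0%N), D, s; split=> // [n|]; first by have [] := sP n.
have Vx : \forall n \near F, Vp (x n) := xF _ nVp.
have Vt : \forall n \near F, Vz (g n (t n)) := tz _ nVz.
by apply: filterS2 Vx Vt => n Vxn Vtn; apply: CD; have [_] := sP n; apply.
Qed.
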